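(* Let $k$ be a field, let $A$ be a finite-dimensional $k$-algebra such that $A/\mathrm{rad}(A)$ is separable over $k$, and let $n\ge3$ be an integer. There is a morphism of Lie algebras $$\mathrm{HH}^1_{\mathrm{rad}}(A/\mathrm{rad}(A)^n)\longrightarrow\mathrm{HH}^1_{\mathrm{rad}}(A/\mathrm{rad}(A)^{n-1})$$ with abelian kernel. If $\mathrm{HH}^1_{\mathrm{rad}}(A/\mathrm{rad}(A)^{n-1})$ is solvable, then so is $\mathrm{HH}^1_{\mathrm{rad}}(A/\mathrm{rad}(A)^n)$. In particular, if $\mathrm{HH}^1_{\mathrm{rad}}(A/\mathrm{rad}(A)^2)$ is solvable, then so is $\mathrm{HH}^1_{\mathrm{rad}}(A)$.
   Context: For a finite-dimensional algebra $B$ with Jacobson radical $\mathrm{rad}(B)$, $\mathrm{Der}_{\mathrm{rad}}(B)$ is the Lie algebra (under the commutator) of $k$-linear derivations $\delta$ of $B$ with $\delta(\mathrm{rad}(B))\subseteq\mathrm{rad}(B)$; $\mathrm{Inn}(B)=\{[b,-]:b\in B\}$ is the Lie ideal of inner derivations; $\mathrm{HH}^1_{\mathrm{rad}}(B)=\mathrm{Der}_{\mathrm{rad}}(B)/\mathrm{Inn}(B)$. *)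

(* Defs.v *)
From HB Require Import structures.
From mathcomp Require Import all_boot all_order all_algebra all_field.
From mathcomp Require Import generic_quotient ring_quotient boolp.

Set Implicit Arguments.
Unset Strict Implicit.
Unset Printing Implicit Defensive.

Import GRing.Theory.

Local Open Scope ring_scope.
Local Open Scope quotient_scope.

Section SubspacesAndQuotients.
Variables (k : fieldType) (V : vectType k).

Definition subspace_pred (P : V -> Prop) : Prop :=
  P 0 /\ forall a u v, P u -> P v -> P (a *: u + v).

Lemma vspace_of_subproof (P : V -> Prop) : subspace_pred P ->
  {U : {vspace V} | forall x, x \in U <-> P x}.
Proof.
case=> P0 PD; apply: cid.
pose Q (n : nat) := `[< exists2 U : {vspace V}, (forall x, x \in U -> P x) & \dim U = n >].
have exQ : exists n, Q n.
  exists 0; apply/asboolP; exists 0%VS; last exact: dimv0.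
  by move=> x; rewrite memv0 => /eqP ->.
have leQ n : Q n -> (n <= \dim (fullv : {vspace V}))%N.
  by move=> /asboolP[U _ <-]; exact: dimvS (subvf U).
case: (ex_maxnP exQ leQ) => n /asboolP[U PU dimU] maxn.
exists U => x; split; first exact: PU.
move=> Px; suff /eqP-> : U == (U + <[x]>)%VS.
  by apply: (subvP (addvSr U <[x]>%VS)); rewrite memv_line.
rewrite eqEdim addvSl /= dimU; apply: maxn; apply/asboolP.
exists (U + <[x]>)%VS => // _ /memv_addP[u Uu [_ /vlineP[a ->] ->]].
by rewrite addrC; apply: PD => //; apply: PU.
Qed.

Definition vspace_of (P : V -> Prop) (PP : subspace_pred P) : {vspace V} :=
  sval (vspace_of_subproof PP).

Lemma vspace_ofP (P : V -> Prop) (PP : subspace_pred P) x :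
  x \in vspace_of PP <-> P x.
Proof. exact: (svalP (vspace_of_subproof PP)). Qed.

Variable U : {vspace V}.

(* V / U on the library's additive quotient; vpi is the projection and vrepr a
   (non-linear) choice of representatives. *)
Definition vquot : Type := Quotient.quot (pred_of_vspace U).
HB.instance Definition _ := GRing.Zmodule.on vquot.

Definition vpi (x : V) : vquot := \pi x.
Definition vrepr (q : vquot) : V := repr q.

Lemma vreprK : cancel vrepr vpi. Proof. exact: reprK. Qed.

Lemma vpi_eq x y : (vpi x == vpi y) = (x - y \in U).
Proof. by rewrite /vpi -(Quotient.idealrBE (pred_of_vspace U)). Qed.

Lemma vpi_eqP x y : vpi x = vpi y <-> x - y \in U.
Proof. by rewrite -vpi_eq; split => [->|/eqP]. Qed.

Lemma vpi_eq0 x : (vpi x == 0) = (x \in U).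
Proof.
have ->: (0 : vquot) = vpi 0 by rewrite /vpi; exact/esym/(@raddf0 V vquot \pi_(_)).
by rewrite vpi_eq subr0.
Qed.

Lemma vrepr_pi x : vrepr (vpi x) - x \in U.
Proof. by rewrite -vpi_eq vreprK. Qed.

Lemma vpiD x y : vpi (x + y) = vpi x + vpi y.
Proof. by rewrite /vpi; exact: (@raddfD V vquot \pi_(_)). Qed.

Definition vquot_scale (a : k) (q : vquot) : vquot := vpi (a *: vrepr q).

Lemma vpi_scale a x : vquot_scale a (vpi x) = vpi (a *: x).
Proof. by apply/vpi_eqP; rewrite -scalerBr memvZ ?vrepr_pi. Qed.

Fact vquot_scalerA a b q :
  vquot_scale a (vquot_scale b q) = vquot_scale (a * b) q.
Proof. by rewrite -[q]vreprK !vpi_scale scalerA. Qed.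
Fact vquot_scale1r : left_id 1 vquot_scale.
Proof. by move=> q; rewrite -[q]vreprK vpi_scale scale1r. Qed.
Fact vquot_scalerDr : right_distributive vquot_scale +%R.
Proof.
by move=> a p q; rewrite -[p]vreprK -[q]vreprK -vpiD !vpi_scale scalerDr vpiD.
Qed.
Fact vquot_scalerDl q : {morph vquot_scale^~ q : a b / a + b}.
Proof. by move=> a b /=; rewrite -[q]vreprK !vpi_scale scalerDl vpiD. Qed.

HB.instance Definition _ := GRing.Zmodule_isLmodule.Build k vquot
  vquot_scalerA vquot_scale1r vquot_scalerDr vquot_scalerDl.

Lemma vpi_is_linear : linear vpi.
Proof. by move=> a x y; rewrite vpiD -vpi_scale. Qed.
HB.instance Definition _ :=
  GRing.isSemilinear.Build k V vquot _ vpi (GRing.semilinear_linear vpi_is_linear).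

Fact vquot_vect_iso : Vector.axiom (\dim (U^C)) vquot.
Proof.
case: (subvs_vect_iso (U^C)%VS) => v2r v2r_lin v2r_bij.
pose p x : subvs_of (U^C)%VS := vsproj (U^C)%VS (x - projv U x).
have pE x : vsval (p x) = x - projv U x by rewrite vsprojK ?memv_projC.
have pU x : x \in U -> p x = 0.
  by move=> Ux; apply: val_inj; rewrite /= pE projv_id // subrr.
have p_lin : linear p.
  move=> a x y; apply: val_inj => /=; rewrite !pE linearP /=.
  by rewrite scalerBr opprD addrACA.
pose pL : {linear V -> subvs_of (U^C)%VS} :=
  HB.pack p (GRing.isSemilinear.Build k V _ _ p (GRing.semilinear_linear p_lin)).
have p_pi x : p (vrepr (vpi x)) = p x.
  apply/eqP; rewrite -subr_eq0 -[p]/(pL : _ -> _) -linearB /= pU //.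
  exact: vrepr_pi.
have pq_lin : linear (fun q => p (vrepr q)).
  by move=> a u v; rewrite -[u]vreprK -[v]vreprK -vpi_is_linear !p_pi p_lin.
pose pq : {linear vquot -> subvs_of (U^C)%VS} :=
  HB.pack (fun q => p (vrepr q))
    (GRing.isSemilinear.Build k vquot _ _ _ (GRing.semilinear_linear pq_lin)).
exists (fun q => v2r (pq q)).
  by move=> a u v; rewrite linearP v2r_lin.
case: v2r_bij => r2v v2rK r2vK.
exists (fun r => vpi (vsval (r2v r))) => [q|r].
  rewrite v2rK /= pE -[RHS]vreprK; apply/vpi_eqP.
  by rewrite addrAC subrr add0r memvN memv_proj.
rewrite /= p_pi -[RHS]r2vK; congr v2r.
set w := r2v r; apply: val_inj; rewrite /= pE.
suff -> : projv U (vsval w) = 0 by rewrite subr0.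
have -> : projv U (vsval w) = vsval w - daddv_pi (U^C)%VS U (vsval w).
  rewrite -{2}(daddv_pi_add (capv_compl U) (w := vsval w)) ?addv_complf ?memvf //.
  by rewrite addrK.
by rewrite daddv_pi_id ?subrr ?subvsP // capvC capv_compl.
Qed.

HB.instance Definition _ := Lmodule_hasFinDim.Build k vquot vquot_vect_iso.

End SubspacesAndQuotients.

Section Radical.
Variables (k : fieldType) (A : falgType k).
Implicit Types (I L M : {vspace A}).

(* A is unital, so its one-sided and two-sided ideals are automatically
   k-subspaces. *)
Definition left_ideal L : bool := (fullv * L <= L)%VS.
Definition two_sided_ideal I : bool := (fullv * I <= I)%VS && (I * fullv <= I)%VS.

Definition maximal_left_ideal M : Prop :=
  [/\ left_ideal M, M != fullv &
      forall L, left_ideal L -> (M <= L)%VS -> L = M \/ L = fullv].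

Definition in_all_maximal_left_ideals (x : A) : Prop :=
  forall M, maximal_left_ideal M -> x \in M.

Fact in_all_maximal_left_ideals_subspace : subspace_pred in_all_maximal_left_ideals.
Proof.
split=> [M _|a u v Pu Pv M maxM]; first exact: mem0v.
by rewrite memvD ?memvZ ?Pu ?Pv.
Qed.

Definition jacobson_rad : {vspace A} := vspace_of in_all_maximal_left_ideals_subspace.

Lemma jacobson_radP x :
  x \in jacobson_rad <-> forall M, maximal_left_ideal M -> x \in M.
Proof. exact: vspace_ofP. Qed.

Lemma left_idealP L : reflect (forall a x, x \in L -> a * x \in L) (left_ideal L).
Proof.
apply: (iffP prodvP) => [H a x Lx|H a x _ Lx]; last exact: H.
by apply: H => //; exact: memvf.
Qed.

Lemma two_sided_idealP I :
  reflect (forall a x, x \in I -> a * x \in I /\ x * a \in I) (two_sided_ideal I).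
Proof.
apply: (iffP andP) => [[/prodvP H1 /prodvP H2] a x Ix|H].
  by rewrite H1 ?H2 ?memvf.
by split; apply/prodvP => a x Ia Ix; [case: (H a x Ix)|case: (H x a Ia)].
Qed.

Lemma left_ideal_full L : left_ideal L -> 1 \in L -> L = fullv.
Proof.
move=> /left_idealP LL L1; apply/eqP; rewrite eqEsubv subvf /=.
by apply/subvP => x _; rewrite -[x]mulr1 LL.
Qed.

Lemma maximal_left_ideal_exists : exists M, maximal_left_ideal M.
Proof.
pose Q (n : nat) := `[< exists2 M, left_ideal M && (1 \notin M) & \dim M = n >].
have exQ : exists n, Q n.
  exists 0; apply/asboolP; exists 0%VS; last exact: dimv0.
  rewrite memv0 oner_eq0 andbT; apply/left_idealP => a x.
  by rewrite memv0 => /eqP->; rewrite mulr0 mem0v.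
have leQ n : Q n -> (n <= \dim (fullv : {vspace A}))%N.
  by move=> /asboolP[M _ <-]; exact: dimvS (subvf M).
case: (ex_maxnP exQ leQ) => n /asboolP[M /andP[LM M1] dimM] maxn.
exists M; split=> // [|L LL sML].
  by apply: contraNneq M1 => ->; exact: memvf.
case: (boolP (1 \in L)) => L1; [right; exact: left_ideal_full|left].
apply/esym/eqP; rewrite eqEdim sML dimM; apply: maxn.
by apply/asboolP; exists L; rewrite ?LL.
Qed.

Lemma jacobson_rad_ideal : two_sided_ideal jacobson_rad.
Proof.
apply/two_sided_idealP => a x /jacobson_radP Jx; split; apply/jacobson_radP => M maxM;
  have [LM Mf maxL] := maxM; move/left_idealP: (LM) => LM'; first exact/LM'/Jx.
case: (boolP (a \in M)) => Ma; first exact: LM'.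
have sub_a : subspace_pred (fun y => y * a \in M).
  by split=> [|b u v Mu Mv]; rewrite ?mul0r ?mem0v // mulrDl -scalerAl memvD ?memvZ.
pose N := vspace_of sub_a.
have NE y : y \in N <-> y * a \in M by exact: vspace_ofP.
suff maxN : maximal_left_ideal N by apply/NE/Jx.
split.
- by apply/left_idealP => b y /NE My; apply/NE; rewrite -mulrA LM'.
- apply: contraNneq Ma => N1; rewrite -[a]mul1r; apply/NE.
  by rewrite N1 memvf.
move=> L LL sNL.
have /left_idealP LL' := LL.
pose La := (amulr a @: L)%VS.
have ML : left_ideal (M + La)%VS.
  apply/left_idealP => b _ /memv_addP[m Mm [_ /memv_imgP[y Ly ->] ->]].
  rewrite mulrDr memv_add ?LM' //; apply/memv_imgP; exists (b * y); first exact: LL'.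
  by rewrite !lfunE /= mulrA.
case: (maxL _ ML (addvSl _ _)) => E; [left|right].
  apply/eqP; rewrite eqEsubv sNL andbT; apply/subvP => y Ly; apply/NE.
  rewrite -E; apply: (subvP (addvSr M La)); apply/memv_imgP; exists y => //.
  by rewrite lfunE.
apply: left_ideal_full => //.
have : a \in (M + La)%VS by rewrite E memvf.
case/memv_addP => m Mm [_ /memv_imgP[y Ly ->]]; rewrite lfunE /= => aE.
rewrite -[1](subrK y) memvD // (subvP sNL) //; apply/NE.
by rewrite mulrBl mul1r {1}aE addrK.
Qed.

Lemma jacobson_rad_proper : 1 \notin jacobson_rad.
Proof.
have [M maxM] := maximal_left_ideal_exists.
apply/negP => /jacobson_radP/(_ M maxM); case: maxM => LM Mf _ M1.
by rewrite (left_ideal_full LM M1) eqxx in Mf.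
Qed.

(* An falgType is a nonzero algebra, so only proper ideals give quotients that
   are falgTypes. *)
Record proper_two_sided_ideal := TwoSidedIdeal {
  ideal_vspace :> {vspace A};
  proper_ideal_subproof : two_sided_ideal ideal_vspace && (1 \notin ideal_vspace)
}.

Definition rad_ideal : proper_two_sided_ideal :=
  TwoSidedIdeal (introT andP (conj jacobson_rad_ideal jacobson_rad_proper)).

Fact rad_pow_subproof n :
  two_sided_ideal (jacobson_rad ^+ n.-1.+1)%VS && (1 \notin (jacobson_rad ^+ n.-1.+1)%VS).
Proof.
have /andP[fJ Jf] := jacobson_rad_ideal.
apply/andP; split.
  apply/andP; split.
    by rewrite expvSl prodvA prodvSl.
  by rewrite expvSr -prodvA prodvSr.
apply: contra jacobson_rad_proper; apply/subvP.
by rewrite expvSl (subv_trans _ Jf) // prodvSr // subvf.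
Qed.

(* The ideal rad(A)^n for n > 0. The predecessor only matters at n = 0, where
   the library sets U ^+ 0 = <[1]>, which is not an ideal. *)
Definition rad_pow_ideal (n : nat) : proper_two_sided_ideal := TwoSidedIdeal (rad_pow_subproof n).

Lemma rad_pow_idealE n : (0 < n)%N -> rad_pow_ideal n = (jacobson_rad ^+ n)%VS :> {vspace A}.
Proof. by case: n. Qed.

Variable I : proper_two_sided_ideal.

Definition alg_quot : Type := vquot I.
HB.instance Definition _ := Vector.on alg_quot.

Definition alg_pi : A -> alg_quot := @vpi k A I.
HB.instance Definition _ := GRing.Linear.on alg_pi.

Lemma two_sided_idealMl a x : x \in (I : {vspace A}) -> a * x \in (I : {vspace A}).
Proof.
have /andP[/two_sided_idealP H _] := proper_ideal_subproof I.
by move=> Ix; case: (H a x Ix).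
Qed.

Lemma two_sided_idealMr a x : x \in (I : {vspace A}) -> x * a \in (I : {vspace A}).
Proof.
have /andP[/two_sided_idealP H _] := proper_ideal_subproof I.
by move=> Ix; case: (H a x Ix).
Qed.

Lemma alg_piD x y : alg_pi (x + y) = alg_pi x + alg_pi y.
Proof. exact: linearD. Qed.
Lemma alg_piZ a x : alg_pi (a *: x) = a *: alg_pi x.
Proof. exact: linearZ. Qed.

Definition alg_quot_one : alg_quot := alg_pi 1.
Definition alg_quot_mul (p q : alg_quot) : alg_quot :=
  alg_pi (vrepr p * vrepr q).

Lemma alg_reprK (q : alg_quot) : alg_pi (vrepr q) = q.
Proof. exact: vreprK. Qed.

Lemma alg_pi_mul x y : alg_quot_mul (alg_pi x) (alg_pi y) = alg_pi (x * y).
Proof.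
apply/vpi_eqP; set x' := vrepr _; set y' := vrepr _.
have -> : x' * y' - x * y = (x' - x) * y' + x * (y' - y).
  by rewrite mulrBl mulrBr addrA subrK.
apply: memvD; [apply: two_sided_idealMr | apply: two_sided_idealMl];
  exact: vrepr_pi.
Qed.

Fact alg_quot_mulA : associative alg_quot_mul.
Proof.
move=> p q r; rewrite -[p]alg_reprK -[q]alg_reprK -[r]alg_reprK.
by rewrite !alg_pi_mul mulrA.
Qed.
Fact alg_quot_mul1r : left_id alg_quot_one alg_quot_mul.
Proof. by move=> p; rewrite -[p]alg_reprK alg_pi_mul mul1r. Qed.
Fact alg_quot_mulr1 : right_id alg_quot_one alg_quot_mul.
Proof. by move=> p; rewrite -[p]alg_reprK alg_pi_mul mulr1. Qed.
Fact alg_quot_mulDl : left_distributive alg_quot_mul +%R.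
Proof.
move=> p q r; rewrite -[p]alg_reprK -[q]alg_reprK -[r]alg_reprK.
by rewrite -(alg_piD (vrepr p)) !alg_pi_mul mulrDl alg_piD.
Qed.
Fact alg_quot_mulDr : right_distributive alg_quot_mul +%R.
Proof.
move=> p q r; rewrite -[p]alg_reprK -[q]alg_reprK -[r]alg_reprK.
by rewrite -(alg_piD (vrepr q)) !alg_pi_mul mulrDr alg_piD.
Qed.
Fact alg_quot_oner_neq0 : alg_quot_one != 0.
Proof. by rewrite [_ == _]vpi_eq0; case/andP: (proper_ideal_subproof I). Qed.

HB.instance Definition _ := GRing.Zmodule_isNzRing.Build alg_quot
  alg_quot_mulA alg_quot_mul1r alg_quot_mulr1
  alg_quot_mulDl alg_quot_mulDr alg_quot_oner_neq0.

Lemma alg_piM x y : alg_pi (x * y) = alg_pi x * alg_pi y.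
Proof. by rewrite -alg_pi_mul. Qed.

Fact alg_quot_scalerAl (a : k) (p q : alg_quot) : a *: (p * q) = (a *: p) * q.
Proof.
rewrite -[p]alg_reprK -[q]alg_reprK.
by rewrite -alg_piM -!alg_piZ -alg_piM scalerAl.
Qed.
HB.instance Definition _ := GRing.Lmodule_isLalgebra.Build k alg_quot alg_quot_scalerAl.

Fact alg_quot_scalerAr (a : k) (p q : alg_quot) : a *: (p * q) = p * (a *: q).
Proof.
rewrite -[p]alg_reprK -[q]alg_reprK.
by rewrite -alg_piM -!alg_piZ -alg_piM scalerAr.
Qed.
HB.instance Definition _ := GRing.Lalgebra_isAlgebra.Build k alg_quot alg_quot_scalerAr.
HB.instance Definition _ := Algebra_isFalgebra.Build k alg_quot.

Fact alg_pi_monoid_morphism : monoid_morphism alg_pi.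
Proof. by split=> // x y; rewrite alg_piM. Qed.
HB.instance Definition _ :=
  GRing.isMonoidMorphism.Build A alg_quot alg_pi alg_pi_monoid_morphism.

Lemma alg_pi_eq0 x : (alg_pi x == 0) = (x \in (I : {vspace A})).
Proof. exact: vpi_eq0. Qed.

End Radical.

HB.mixin Record Vector_isLie (k : fieldType) (L : Type) of Vector k L := {
  lie : L -> L -> L;
  lie_is_linearl : forall z, linear (lie^~ z);
  lie_is_linearr : forall z, linear (lie z);
  liexx : forall x, lie x x = 0;
  lie_jacobi : forall x y z, lie x (lie y z) + lie y (lie z x) + lie z (lie x y) = 0
}.

#[short(type="lieAlgType")]
HB.structure Definition LieAlgebra (k : fieldType) :=
  {L of Vector k L & Vector_isLie k L}.

Definition lie_morphism (k : fieldType) (L M : lieAlgType k) (f : 'Hom(L, M)) : Prop :=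
  forall x y, f (lie x y) = lie (f x) (f y).

Definition abelian_subspace (k : fieldType) (L : lieAlgType k) (U : {vspace L}) : Prop :=
  {in U &, forall x y, lie x y = 0}.

Section LieTheory.
Variables (k : fieldType) (L : lieAlgType k).

(* The span [U, V] of all brackets of elements of U and V: by bilinearity the
   brackets of basis vectors suffice, see lievP. *)
Definition liev (U V : {vspace L}) : {vspace L} :=
  <<[seq lie x y | x <- vbasis U, y <- vbasis V]>>%VS.

Lemma lieDl (x y z : L) : lie (x + y) z = lie x z + lie y z.
Proof. by have := lie_is_linearl z 1 x y; rewrite !scale1r. Qed.

Lemma lieDr (z x y : L) : lie z (x + y) = lie z x + lie z y.
Proof. by have := lie_is_linearr z 1 x y; rewrite !scale1r. Qed.

Lemma lie0l (z : L) : lie 0 z = 0.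
Proof. by apply: (addrI (lie 0 z)); rewrite -lieDl !addr0. Qed.

Lemma lie0r (z : L) : lie z 0 = 0.
Proof. by apply: (addrI (lie z 0)); rewrite -lieDr !addr0. Qed.

Lemma lieZl (a : k) (x z : L) : lie (a *: x) z = a *: lie x z.
Proof. by have := lie_is_linearl z a x 0; rewrite lie0l !addr0. Qed.

Lemma lieZr (a : k) (z x : L) : lie z (a *: x) = a *: lie z x.
Proof. by have := lie_is_linearr z a x 0; rewrite lie0r !addr0. Qed.

Lemma lieC (x y : L) : lie x y = - lie y x.
Proof.
apply/eqP; rewrite -addr_eq0; apply/eqP.
by have := liexx (x + y); rewrite lieDl !lieDr !liexx add0r addr0.
Qed.

Lemma lie_suml (I : Type) (r : seq I) (F : I -> L) z :
  lie (\sum_(i <- r) F i) z = \sum_(i <- r) lie (F i) z.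
Proof. by apply: (big_morph (fun u => lie u z)) => [x y|]; rewrite ?lieDl ?lie0l. Qed.

Lemma lie_sumr (I : Type) (r : seq I) (F : I -> L) z :
  lie z (\sum_(i <- r) F i) = \sum_(i <- r) lie z (F i).
Proof. by apply: big_morph => [x y|]; rewrite ?lieDr ?lie0r. Qed.

Lemma lievP (U V W : {vspace L}) :
  reflect {in U & V, forall x y, lie x y \in W} (liev U V <= W)%VS.
Proof.
apply: (iffP span_subvP) => [H x y Ux Vy|H].
  rewrite (coord_vbasis Ux) (coord_vbasis Vy) lie_suml memv_suml // => i _.
  rewrite lie_sumr memv_suml // => j _; rewrite lieZl lieZr !memvZ //.
  by apply/H/allpairsP; exists ((vbasis U)`_i, (vbasis V)`_j); rewrite !memt_nth.
by move=> _ /allpairsP[[x y] /= [Ux Vy ->]]; rewrite H ?vbasis_mem.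
Qed.

Definition derived_series (n : nat) : {vspace L} :=
  iter n (fun U => liev U U) fullv.

Definition solvable_lie : Prop := exists n, derived_series n = 0%VS.

Record lie_ideal := LieIdeal {
  lie_ideal_vspace :> {vspace L};
  lie_ideal_subproof : forall x y, y \in lie_ideal_vspace -> lie x y \in lie_ideal_vspace
}.

Variable I : lie_ideal.

Definition lie_quot : Type := vquot I.
HB.instance Definition _ := Vector.on lie_quot.

Definition lie_pi : L -> lie_quot := @vpi k L I.
HB.instance Definition _ := GRing.Linear.on lie_pi.

Definition lie_quot_lie (p q : lie_quot) : lie_quot := lie_pi (lie (vrepr p) (vrepr q)).

Lemma lie_reprK (q : lie_quot) : lie_pi (vrepr q) = q.
Proof. exact: vreprK. Qed.

Lemma lie_pi_eq0 x : (lie_pi x == 0) = (x \in (I : {vspace L})).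
Proof. exact: vpi_eq0. Qed.

Lemma lie_ideal_memr x y : y \in (I : {vspace L}) -> lie x y \in (I : {vspace L}).
Proof. exact: lie_ideal_subproof. Qed.

Lemma lie_ideal_meml x y : x \in (I : {vspace L}) -> lie x y \in (I : {vspace L}).
Proof. by move=> Ix; rewrite lieC memvN lie_ideal_memr. Qed.

Lemma lie_pi_linear : linear lie_pi.
Proof. exact: vpi_is_linear. Qed.

Lemma lie_pi_lie x y : lie_quot_lie (lie_pi x) (lie_pi y) = lie_pi (lie x y).
Proof.
apply/vpi_eqP; set x' := vrepr _; set y' := vrepr _.
have -> : lie x' y' - lie x y = lie (x' - x) y' + lie x (y' - y).
  by rewrite lieDl lieDr -!scaleN1r lieZl lieZr !scaleN1r addrA subrK.
by apply: memvD; [apply: lie_ideal_meml | apply: lie_ideal_memr]; exact: vrepr_pi.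
Qed.

Fact lie_quot_linearl r : linear (lie_quot_lie^~ r).
Proof.
move=> a p q /=; rewrite -[p]lie_reprK -[q]lie_reprK -[r]lie_reprK.
by rewrite -lie_pi_linear !lie_pi_lie lieDl lieZl lie_pi_linear.
Qed.
Fact lie_quot_linearr r : linear (lie_quot_lie r).
Proof.
move=> a p q /=; rewrite -[p]lie_reprK -[q]lie_reprK -[r]lie_reprK.
by rewrite -lie_pi_linear !lie_pi_lie lieDr lieZr lie_pi_linear.
Qed.
Fact lie_quot_xx q : lie_quot_lie q q = 0.
Proof. by rewrite -[q]lie_reprK lie_pi_lie liexx linear0. Qed.
Fact lie_quot_jacobi p q r :
  lie_quot_lie p (lie_quot_lie q r) + lie_quot_lie q (lie_quot_lie r p)
    + lie_quot_lie r (lie_quot_lie p q) = 0.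
Proof.
rewrite -[p]lie_reprK -[q]lie_reprK -[r]lie_reprK.
by rewrite !lie_pi_lie -!linearD lie_jacobi linear0.
Qed.

HB.instance Definition _ := Vector_isLie.Build k lie_quot
  lie_quot_linearl lie_quot_linearr lie_quot_xx lie_quot_jacobi.

End LieTheory.

Arguments solvable_lie {k} L.

Section Derivations.
Variables (k : fieldType) (B : falgType k).
Implicit Types f g : 'End(B).

Definition rad_derivation f : Prop :=
  (forall x y, f (x * y) = f x * y + x * f y) /\
  (forall x, x \in jacobson_rad B -> f x \in jacobson_rad B).

Fact rad_derivation_subspace : subspace_pred rad_derivation.
Proof.
split=> [|a f g [Df Jf] [Dg Jg]]; split=> [x y|x Jx].
- by rewrite !lfunE /= mul0r mulr0 addr0.
- by rewrite lfunE mem0v.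
- rewrite !(add_lfunE, scale_lfunE) Df Dg scalerDr !mulrDl !mulrDr.
  by rewrite -!scalerAl -!scalerAr addrACA.
- by rewrite !(add_lfunE, scale_lfunE) memvD ?memvZ ?Jf ?Jg.
Qed.

Definition Der_rad_vspace : {vspace 'End(B)} := vspace_of rad_derivation_subspace.

Lemma Der_rad_vspaceP f : f \in Der_rad_vspace <-> rad_derivation f.
Proof. exact: vspace_ofP. Qed.

Definition lfun_commutator f g : 'End(B) := ((f \o g) - (g \o f))%VF.

Lemma lfun_commutatorE f g x : lfun_commutator f g x = f (g x) - g (f x).
Proof. by rewrite /lfun_commutator add_lfunE opp_lfunE !comp_lfunE. Qed.

Lemma lfun_commutator_mem f g : f \in Der_rad_vspace -> g \in Der_rad_vspace ->
  lfun_commutator f g \in Der_rad_vspace.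
Proof.
move=> /Der_rad_vspaceP[Df Jf] /Der_rad_vspaceP[Dg Jg].
apply/Der_rad_vspaceP; split=> [x y|x Jx]; rewrite !lfun_commutatorE; last first.
  by apply: memvB; [apply/Jf/Jg | apply/Jg/Jf].
rewrite Df Dg !linearD /= !Df !Dg mulrBl mulrBr !opprD.
by rewrite [LHS](AC ((2*2)*(2*2)) ((1*5)*(4*8)*(2*7)*(3*6)))/= !subrr !addr0.
Qed.

Definition Der_rad : Type := subvs_of Der_rad_vspace.
HB.instance Definition _ := Vector.on Der_rad.

Definition Der_rad_fun (d : Der_rad) : 'End(B) := vsval d.

Lemma Der_rad_fun_linear : linear Der_rad_fun. Proof. by []. Qed.
HB.instance Definition _ := GRing.isSemilinear.Build k Der_rad 'End(B) _ Der_rad_fun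
  (GRing.semilinear_linear Der_rad_fun_linear).

Lemma Der_rad_fun_inj : injective Der_rad_fun.
Proof. exact: val_inj. Qed.

Lemma Der_rad_funD a (d e : Der_rad) x :
  Der_rad_fun (a *: d + e) x = a *: Der_rad_fun d x + Der_rad_fun e x.
Proof. by rewrite Der_rad_fun_linear add_lfunE scale_lfunE. Qed.

Lemma Der_rad_fun_add (d e : Der_rad) x :
  Der_rad_fun (d + e) x = Der_rad_fun d x + Der_rad_fun e x.
Proof. by have := Der_rad_funD 1 d e x; rewrite !scale1r. Qed.

Lemma Der_rad_fun0 x : Der_rad_fun 0 x = 0.
Proof. by rewrite raddf0 zero_lfunE. Qed.

Lemma Der_radP (d : Der_rad) : rad_derivation (Der_rad_fun d).
Proof. exact/Der_rad_vspaceP/subvsP. Qed.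

Definition Der_rad_lie (d e : Der_rad) : Der_rad :=
  Subvs (lfun_commutator_mem (subvsP d) (subvsP e)).

Lemma Der_rad_lieE d e x :
  Der_rad_fun (Der_rad_lie d e) x =
    Der_rad_fun d (Der_rad_fun e x) - Der_rad_fun e (Der_rad_fun d x).
Proof. exact: lfun_commutatorE. Qed.

Fact Der_rad_lie_linearl z : linear (Der_rad_lie^~ z).
Proof.
move=> a d e; apply: Der_rad_fun_inj; apply/lfunP => x.
rewrite Der_rad_funD !Der_rad_lieE !Der_rad_funD linearP /=.
by rewrite scalerBr opprD addrACA.
Qed.

Fact Der_rad_lie_xx d : Der_rad_lie d d = 0.
Proof.
by apply: Der_rad_fun_inj; apply/lfunP => x; rewrite Der_rad_lieE subrr Der_rad_fun0.
Qed.

Fact Der_rad_lie_linearr z : linear (Der_rad_lie z).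
Proof.
move=> a d e; apply: Der_rad_fun_inj; apply/lfunP => x.
rewrite Der_rad_funD !Der_rad_lieE !Der_rad_funD linearP /=.
by rewrite scalerBr opprD addrACA.
Qed.

Fact Der_rad_lie_jacobi c d e :
  Der_rad_lie c (Der_rad_lie d e) + Der_rad_lie d (Der_rad_lie e c)
    + Der_rad_lie e (Der_rad_lie c d) = 0.
Proof.
apply: Der_rad_fun_inj; apply/lfunP => x.
rewrite Der_rad_fun0 !Der_rad_fun_add !Der_rad_lieE.
rewrite !opprB !linearB /=.
by rewrite (AC (((2*2)*(2*2))*(2*2))
  ((1*12)*(7*2)*(3*10)*(5*4)*(11*6)*(9*8)))/= !subrr !addr0.
Qed.

HB.instance Definition _ := Vector_isLie.Build k Der_rad
  Der_rad_lie_linearl Der_rad_lie_linearr Der_rad_lie_xx Der_rad_lie_jacobi.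

(* The inner derivation [b, -]. *)
Definition inner (b : B) : 'End(B) := amull b - amulr b.

Lemma innerE b x : inner b x = b * x - x * b.
Proof. by rewrite /inner add_lfunE opp_lfunE !lfunE. Qed.

Lemma inner_linear : linear inner.
Proof.
move=> a b c; apply/lfunP => x; rewrite innerE add_lfunE scale_lfunE !innerE.
by rewrite mulrDl mulrDr -scalerAl -scalerAr scalerBr opprD addrACA.
Qed.
HB.instance Definition _ := GRing.isSemilinear.Build k B 'End(B) _ inner
  (GRing.semilinear_linear inner_linear).

Lemma inner_rad_derivation b : rad_derivation (inner b).
Proof.
have /two_sided_idealP JJ := jacobson_rad_ideal B.
split=> [x y|x Jx]; rewrite !innerE.
  by rewrite mulrBl mulrBr !mulrA addrA subrK.
by have [Jl Jr] := JJ b x Jx; rewrite memvB.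
Qed.

Definition is_inner (d : Der_rad) : Prop := exists b : B, Der_rad_fun d = inner b.

Fact is_inner_subspace : subspace_pred is_inner.
Proof.
split=> [|a d e [b Eb] [c Ec]]; first by exists 0; rewrite !raddf0.
by exists (a *: b + c); rewrite Der_rad_fun_linear inner_linear Eb Ec.
Qed.

Fact is_inner_ideal (d e : Der_rad) :
  e \in vspace_of is_inner_subspace -> lie d e \in vspace_of is_inner_subspace.
Proof.
move=> /vspace_ofP[b Eb]; apply/vspace_ofP; exists (Der_rad_fun d b).
apply/lfunP => x; rewrite Der_rad_lieE Eb !innerE linearB /=.
have [Dd _] := Der_radP d; rewrite !Dd opprB opprD.
by rewrite [LHS](AC ((2*2)*2) ((1*4)*(2*6)*(5*3)))/= !subrr !addr0.
Qed.

Definition Inn : lie_ideal Der_rad := LieIdeal is_inner_ideal.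

Lemma InnP (d : Der_rad) :
  d \in (Inn : {vspace Der_rad}) <->
  exists b : B, forall x, Der_rad_fun d x = b * x - x * b.
Proof.
split=> [/vspace_ofP[b Eb]|[b Eb]].
  by exists b => x; rewrite Eb innerE.
by apply/vspace_ofP; exists b; apply/lfunP => x; rewrite innerE.
Qed.

Definition HH1_rad : Type := lie_quot Inn.
HB.instance Definition _ := LieAlgebra.on HH1_rad.

End Derivations.

Section Separable.
Import VectorInternalTheory.
Variables (k : fieldType) (B : falgType k).

(* In coordinates B is k^d, and the tensor product of B with itself over k is
   the space of d x d matrices, with x (x) y the rank-one matrix
   (v2r x)^T *m v2r y. The actions a (x (x) y) = (a x) (x) y and
   (x (x) y) b = x (x) (y b) act on the two coordinates separately. *)
Definition tensor_square : Type := 'M[k]_(dim B).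
HB.instance Definition _ := Vector.on tensor_square.

Definition tensor (x y : B) : tensor_square := (v2r x)^T *m v2r y.

Definition tensor_lact (a : B) (t : tensor_square) : tensor_square :=
  (lin1_mx (v2r \o amull a \o r2v))^T *m t.

Definition tensor_ract (b : B) (t : tensor_square) : tensor_square :=
  t *m lin1_mx (v2r \o amulr b \o r2v).

Definition tensor_mul (t : tensor_square) : B :=
  \sum_i \sum_j t i j *: (r2v (delta_mx 0 i) * r2v (delta_mx 0 j)).

Lemma tensor_basis i j : tensor (r2v (delta_mx 0 i)) (r2v (delta_mx 0 j)) = delta_mx i j.
Proof. by rewrite /tensor !r2vK trmx_delta mul_delta_mx. Qed.

Lemma tensor_lactE a x y : tensor_lact a (tensor x y) = tensor (a * x) y.
Proof. by rewrite /tensor_lact /tensor mulmxA -trmx_mul mul_rV_lin1 /= v2rK lfunE. Qed.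

Lemma tensor_ractE b x y : tensor_ract b (tensor x y) = tensor x (y * b).
Proof. by rewrite /tensor_ract /tensor -mulmxA mul_rV_lin1 /= v2rK lfunE. Qed.

Lemma r2v_delta_sum (x : B) : x = \sum_i v2r x 0 i *: r2v (delta_mx 0 i).
Proof.
rewrite -{1}[x]v2rK {1}[v2r x]row_sum_delta linear_sum /=.
by apply: eq_bigr => i _; rewrite linearZ.
Qed.

Lemma tensor_mulE x y : tensor_mul (tensor x y) = x * y.
Proof.
rewrite {2}[x]r2v_delta_sum {2}[y]r2v_delta_sum mulr_suml.
apply: eq_bigr => i _; rewrite mulr_sumr; apply: eq_bigr => j _.
by rewrite mxE big_ord1 !mxE -scalerAl -scalerAr scalerA.
Qed.

(* B is projective as a B-B-bimodule, i.e. the multiplication map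
   B (x) B -> B has a section that is a morphism of bimodules. *)
Definition separable_algebra : Prop :=
  exists s : 'Hom(B, tensor_square),
    (forall a x b, s (a * x * b) = tensor_ract b (tensor_lact a (s x))) /\
    (forall x, tensor_mul (s x) = x).

End Separable.

(* Main.v *)
Require Import Defs.
From HB Require Import structures.
From mathcomp Require Import all_boot all_order all_algebra all_field.

Set Implicit Arguments.
Unset Strict Implicit.
Unset Printing Implicit Defensive.

Import GRing.Theory.
Local Open Scope ring_scope.

(** Write [J] for the Jacobson radical of an algebra [B].  Let [f : B -> C] be a
    surjective algebra morphism whose kernel is the power [J ^ m], with
    [m >= 2] and [J ^ (m + 1) = 0].  By the Leibniz rule a derivation preserving
    [J] preserves [J ^ m], hence descends to [C]; as [rad C = f (J)], the
    descended derivation preserves [rad C].  Inner derivations descend to inner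
    ones, so this gives a Lie morphism [HH1_rad B -> HH1_rad C].

    Its kernel is abelian.  If the image of [d] is the inner derivation of
    [f b], then [d - [b, -]] represents the same class and has values in
    [J ^ m].  Two derivations [d], [e] with values in [J ^ m] satisfy
    [d (J ^ 2) <= J * d B + d B * J <= J ^ (m + 1) = 0] while
    [e B <= J ^ m <= J ^ 2], so [d \o e = 0], likewise [e \o d = 0], and the
    bracket vanishes on the nose.

    The projection from [A / rad(A) ^ n] to [A / rad(A) ^ (n - 1)] is of this
    form with [m = n - 1].  So is the projection from [A] to
    [A / rad(A) ^ m] for every [m >= 2] with [rad(A) ^ m = 0]; such [m] exist
    because the radical is nilpotent, by Nakayama's lemma.  Solvability passes
    back along a Lie morphism with abelian kernel, which gives the two remaining
    claims, the last one by induction starting from [A / rad(A) ^ 2]. *)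

(** * Solvability along a Lie morphism with abelian kernel *)

Section SolvableLift.
Variables (k : fieldType) (L M : lieAlgType k) (f : 'Hom(L, M)).
Hypothesis fL : lie_morphism f.

Lemma limg_derived_series n :
  (f @: derived_series L n <= derived_series M n)%VS.
Proof.
elim: n => [|n IHn]; first exact: subvf.
apply/subvP => _ /memv_imgP[x Dx ->]; rewrite memv_preim.
apply: (subvP _ _ Dx); apply/lievP => y z Dy Dz; rewrite -memv_preim fL.
by have /lievP := subvv (derived_series M n.+1); apply;
  apply: (subvP IHn); apply: memv_img.
Qed.

Lemma solvable_lie_lift :
  abelian_subspace (lker f) -> solvable_lie M -> solvable_lie L.
Proof.
move=> abK [n Mn0]; exists n.+1.
have sDK : (derived_series L n <= lker f)%VS.
  by rewrite lkerE -subv0 -Mn0 limg_derived_series.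
apply/eqP; rewrite -subv0; apply/lievP => x y Dx Dy.
by rewrite abK ?mem0v // (subvP sDK).
Qed.

End SolvableLift.

(** * Linear maps and their kernels *)

Section LinearFactor.
Variables (k : fieldType) (U V W : vectType k) (p : 'Hom(V, W)).

Lemma limg_fullP : limg p = fullv -> forall y, exists x, y = p x.
Proof.
by move=> p_onto y; have := memvf y; rewrite -p_onto => /memv_imgP[x _ ->]; exists x.
Qed.

Lemma memv_limg_lker (L : {vspace V}) x :
  (lker p <= L)%VS -> (p x \in (p @: L)%VS) = (x \in L).
Proof.
move=> /subvP sKL; apply/idP/idP => [/memv_imgP[y Ly Exy]|]; last exact: memv_img.
by rewrite -(subrK y x) memvD // sKL // memv_ker linearB /= Exy subrr.
Qed.

(** A linear map [g] vanishing on [lker p] factors through [p], the factor on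
    [limg p] being [g \o p^-1]. *)
Lemma lfun_factor (g : 'Hom(V, U)) x :
  (lker p <= lker g)%VS -> g (p^-1%VF (p x)) = g x.
Proof.
move=> /subvP sKpg; apply/eqP; rewrite -subr_eq0 -linearB -memv_ker.
by apply: sKpg; rewrite memv_ker linearB /= limg_lfunVK ?memv_img ?memvf ?subrr.
Qed.

End LinearFactor.

(** * The radical under a surjective morphism *)

Section RadicalImage.
Variables (k : fieldType) (B C : falgType k) (f : 'AHom(B, C)).
Hypothesis f_onto : limg f = fullv.

Lemma maximal_left_ideal_preim (M : {vspace C}) :
  maximal_left_ideal M -> maximal_left_ideal (f @^-1: M)%VS.
Proof.
case=> LM Mf maxM; have /left_idealP LM' := LM; split.
- by apply/left_idealP => a x; rewrite -!memv_preim rmorphM; apply: LM'.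
- apply: contraNneq Mf => E; rewrite -[M](lpreimK (f := f)) ?f_onto ?subvf //.
  by rewrite E f_onto.
move=> L /left_idealP LL sML.
have fLL : left_ideal (f @: L)%VS.
  apply/left_idealP => c _ /memv_imgP[y Ly ->]; have [b ->] := limg_fullP f_onto c.
  by rewrite -rmorphM memv_img ?LL.
have sMfL : (M <= f @: L)%VS.
  by rewrite -[M](lpreimK (f := f)) ?limgS ?f_onto ?subvf.
have sKL : (lker f <= L)%VS.
  by rewrite -lpreim0 (subv_trans _ sML) // lpreimS ?sub0v.
case: (maxM _ fLL sMfL) => E; [left|right].
  apply/eqP; rewrite eqEsubv sML andbT; apply/subvP => x Lx.
  by rewrite -memv_preim -E memv_img.
apply/eqP; rewrite eqEsubv subvf; apply/subvP => x _.
by rewrite -(memv_limg_lker x sKL) E memvf.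
Qed.

Lemma maximal_left_ideal_limg (M : {vspace B}) :
  (lker f <= M)%VS -> maximal_left_ideal M -> maximal_left_ideal (f @: M)%VS.
Proof.
move=> sKM [/left_idealP LM Mf maxM].
split.
- apply/left_idealP => c _ /memv_imgP[y My ->]; have [b ->] := limg_fullP f_onto c.
  by rewrite -rmorphM memv_img ?LM.
- apply: contraNneq Mf => E; rewrite eqEsubv subvf; apply/subvP => x _.
  by rewrite -(memv_limg_lker x sKM) E memvf.
move=> L /left_idealP LL sML.
have pLL : left_ideal (f @^-1: L)%VS.
  by apply/left_idealP => a x; rewrite -!memv_preim rmorphM; apply: LL.
have sMpL : (M <= f @^-1: L)%VS.
  by apply/subvP => x Mx; rewrite -memv_preim (subvP sML) ?memv_img.
have LE : (f @: (f @^-1: L))%VS = L by rewrite lpreimK ?f_onto ?subvf.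
by case: (maxM _ pLL sMpL) => E; [left|right]; rewrite -LE E.
Qed.

Lemma jacobson_rad_limg :
  (lker f <= jacobson_rad B)%VS -> (f @: jacobson_rad B)%VS = jacobson_rad C.
Proof.
move=> sKJ; apply/eqP; rewrite eqEsubv; apply/andP; split; apply/subvP => y.
  case/memv_imgP => x /jacobson_radP Jx ->; apply/jacobson_radP => M maxM.
  by rewrite memv_preim; apply/Jx/maximal_left_ideal_preim.
move=> /jacobson_radP Jy; have [x Ey] := limg_fullP f_onto y.
rewrite Ey memv_img //; apply/jacobson_radP => M maxM.
have sKM : (lker f <= M)%VS.
  by apply: subv_trans sKJ _; apply/subvP => z /jacobson_radP; apply.
rewrite -(memv_limg_lker x sKM) -Ey.
exact: Jy (maximal_left_ideal_limg sKM maxM).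
Qed.

End RadicalImage.

(** * Nilpotence of the radical *)

Section RadicalNilpotent.
Variables (k : fieldType) (B : falgType k).
Local Notation J := (jacobson_rad B).

Lemma left_ideal_maximal_sub (L : {vspace B}) : left_ideal L -> L != 0%VS ->
  exists N, [/\ left_ideal N, (N <= L)%VS, N != L &
    forall P, left_ideal P -> (N <= P)%VS -> (P <= L)%VS -> P = N \/ P = L].
Proof.
move=> LL nzL.
(* Induction on the codimension in L of a proper left ideal N of L, from N = 0. *)
suff H d : forall N, left_ideal N -> (N <= L)%VS -> N != L ->
    (\dim L - \dim N <= d)%N ->
    exists N, [/\ left_ideal N, (N <= L)%VS, N != L &
    forall P, left_ideal P -> (N <= P)%VS -> (P <= L)%VS -> P = N \/ P = L].
  apply: (H (\dim L) 0%VS); rewrite ?sub0v 1?eq_sym ?leq_subr //.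
  by apply/left_idealP => a x; rewrite memv0 => /eqP->; rewrite mulr0 mem0v.
elim: d => [|d IHd] N LN sNL neNL.
  by rewrite leqn0 subn_eq0 => led; case/negP: neNL; rewrite eqEdim sNL.
move=> led.
case: (boolp.EM (exists P, [/\ left_ideal P, (N <= P)%VS, (P <= L)%VS, P != N & P != L])).
  case=> P [LP sNP sPL nePN nePL]; apply: (IHd P) => //.
  have: (\dim N < \dim P)%N by rewrite (ltn_leqif (dimv_leqif_eq sNP)) eq_sym.
  move=> ltNP; rewrite -ltnS (leq_trans _ led) // ltn_sub2l //.
  exact: leq_trans ltNP (dimvS sPL).
move=> noP; exists N; split=> // P LP sNP sPL.
case: (eqVneq P N) => [->|nePN]; [by left|right].
by apply/eqP; apply: contra_notT noP => nePL; exists P.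
Qed.

(** Nakayama's lemma.  If [N] is a maximal proper left ideal of [L] and [x] lies
    in [L] but not in [N], the annihilator of [x] in the simple module [L / N]
    is a maximal left ideal, so it contains [J]; hence [J * L <= N]. *)
Lemma jacobson_rad_nakayama (L : {vspace B}) :
  left_ideal L -> L != 0%VS -> ~~ (L <= J * L)%VS.
Proof.
move=> LL nzL.
have [N [LN sNL neNL maxN]] := left_ideal_maximal_sub LL nzL.
apply: contra neNL => sLJL; rewrite eqEsubv sNL (subv_trans sLJL) //.
have /left_idealP LN' := LN; have /left_idealP LL' := LL.
apply/prodvP => j x /jacobson_radP Jj Lx.
case: (boolP (x \in N)) => [Nx|N'x]; first exact: LN'.
(* The annihilator of the class of x in L / N. *)
have memAnn y : (y \in amulr x @^-1: N)%VS = (y * x \in N).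
  by rewrite -memv_preim lfunE.
suff maxAnn : maximal_left_ideal (amulr x @^-1: N)%VS by rewrite -memAnn Jj.
split.
- by apply/left_idealP => a y; rewrite !memAnn -mulrA; apply: LN'.
- apply: contraNneq N'x => E; rewrite -[x]mul1r -memAnn E memvf //.
move=> P LP sAP; have /left_idealP LP' := LP.
have LNP : left_ideal (N + amulr x @: P)%VS.
  apply/left_idealP => a _ /memv_addP[n Nn [_ /memv_imgP[y Py ->] ->]].
  rewrite mulrDr memv_add ?LN' //; apply/memv_imgP; exists (a * y); first exact: LP'.
  by rewrite !lfunE /= mulrA.
have sNPL : (N + amulr x @: P <= L)%VS.
  rewrite subv_add sNL; apply/subvP => _ /memv_imgP[y _ ->].
  by rewrite lfunE LL'.
case: (maxN _ LNP (addvSl _ _) sNPL) => E; [left|right].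
  apply/eqP; rewrite eqEsubv sAP andbT; apply/subvP => y Py; rewrite memAnn -E.
  apply: (subvP (addvSr _ _)); apply/memv_imgP; exists y => //.
  by rewrite lfunE.
apply: left_ideal_full => //.
have : x \in (N + amulr x @: P)%VS by rewrite E.
case/memv_addP => n Nn [_ /memv_imgP[y Py ->]]; rewrite lfunE /= => Ex.
rewrite -[1](subrK y) memvD // (subvP sAP) // memAnn.
by rewrite mulrBl mul1r {1}Ex addrK.
Qed.

Lemma jacobson_radX_ideal n : left_ideal (J ^+ n.+1)%VS.
Proof.
have /andP[fJ _] := jacobson_rad_ideal B.
by rewrite /left_ideal expvSl prodvA prodvSl.
Qed.

Lemma jacobson_radX_sub m n : (m <= n)%N -> (J ^+ n.+1 <= J ^+ m.+1)%VS.
Proof.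
move=> lemn; rewrite -(subnK lemn) -addnS expvD.
by rewrite (subv_trans _ (jacobson_radX_ideal m)) ?prodvSl ?subvf.
Qed.

Lemma jacobson_rad_nilpotent : exists n, (J ^+ n.+1 = 0)%VS.
Proof.
(* Each further power of J has strictly smaller dimension until it vanishes. *)
suff H n : (J ^+ n.+1 == 0)%VS || (\dim (J ^+ n.+1) + n <= \dim J)%N.
  exists (\dim J).+1; case/orP: (H (\dim J).+1) => [/eqP // | ].
  by rewrite addnS ltnNge leq_addl.
elim: n => [|n IHn]; first by rewrite expv1 addn0 leqnn orbT.
rewrite orbC -implyNb; apply/implyP.
have sS : (J ^+ n.+2 <= J ^+ n.+1)%VS by exact: jacobson_radX_sub.
case: (eqVneq (J ^+ n.+1)%VS 0%VS) IHn => [E _ _|nz /= le].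
  by rewrite expvSl E prodv0.
case/negP; rewrite addnS -addSn (leq_trans _ le) // leq_add2r.
rewrite ltnNge; apply: contra (jacobson_rad_nakayama (jacobson_radX_ideal n) nz).
by move=> led; rewrite -expvSl -(geq_leqif (dimv_leqif_sup sS)).
Qed.

End RadicalNilpotent.

(** * Derivations and powers of the radical *)

Section DerivationsOfPowers.
Variables (k : fieldType) (B : falgType k) (d : 'End(B)).
Hypothesis dD : rad_derivation d.
Local Notation J := (jacobson_rad B).

Lemma rad_derivation_radX n x : x \in (J ^+ n.+1)%VS -> d x \in (J ^+ n.+1)%VS.
Proof.
have [dM dJ] := dD; elim: n x => [|n IHn] x; first exact: dJ.
rewrite expvSl memv_preim; apply/subvP/prodvP => y z Jy Jz.
by rewrite -memv_preim dM memvD ?memv_mul ?dJ ?IHn.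
Qed.

Lemma rad_derivation_rad_sqr n x : (limg d <= J ^+ n)%VS ->
  x \in (J ^+ 2)%VS -> d x \in (J ^+ n.+1)%VS.
Proof.
have [dM _] := dD; move=> /subvP dJn.
rewrite expv2 memv_preim; apply/subvP/prodvP => y z Jy Jz.
rewrite -memv_preim dM memvD //.
  by rewrite expvSr memv_mul ?dJn ?memv_img ?memvf.
by rewrite expvSl memv_mul ?dJn ?memv_img ?memvf.
Qed.

End DerivationsOfPowers.

(** * Projections between quotient algebras *)

Section QuotientMaps.
Variables (k : fieldType) (A : falgType k).
Implicit Types I : proper_two_sided_ideal A.

Definition alg_pi_ahom I : 'AHom(A, alg_quot I) := linfun_ahom (@alg_pi k A I).

Lemma alg_pi_ahomE I x : alg_pi_ahom I x = alg_pi I x.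
Proof. exact: lfunE. Qed.

Lemma limg_alg_pi I : limg (alg_pi_ahom I) = fullv.
Proof.
apply/vspaceP => q; rewrite memvf; apply/memv_imgP; exists (vrepr q).
  exact: memvf.
by rewrite alg_pi_ahomE alg_reprK.
Qed.

Lemma lker_alg_pi I : lker (alg_pi_ahom I) = I.
Proof. by apply/vspaceP => x; rewrite memv_ker alg_pi_ahomE alg_pi_eq0. Qed.

(** The canonical projection [A / I1 -> A / I2] for [I1 <= I2], whose kernel is
    [I2 / I1]. *)
Lemma alg_quot_ahom I1 I2 : (I1 <= I2)%VS ->
  exists2 f : 'AHom(alg_quot I1, alg_quot I2),
    limg f = fullv & lker f = (alg_pi_ahom I1 @: I2)%VS.
Proof.
move=> sI12; pose p1 := alg_pi_ahom I1; pose p2 := alg_pi_ahom I2.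
pose f := (p2 \o p1^-1)%VF.
have p1_onto : limg p1 = fullv by exact: limg_alg_pi.
have fE x : f (p1 x) = p2 x by rewrite comp_lfunE lfun_factor // !lker_alg_pi.
have fP : ahom_in fullv f.
  apply/ahom_inP; split=> [x y _ _|]; last by rewrite -(rmorph1 p1) fE rmorph1.
  have [a ->] := limg_fullP p1_onto x; have [b ->] := limg_fullP p1_onto y.
  by rewrite -rmorphM !fE rmorphM.
exists (AHom fP) => /=.
  apply/vspaceP => q; rewrite memvf.
  have [a ->] := limg_fullP (limg_alg_pi I2) q.
  by rewrite -fE memv_img ?memvf.
apply/vspaceP => x; have [a ->] := limg_fullP p1_onto x.
rewrite memv_ker fE -memv_ker lker_alg_pi; apply/idP/memv_imgP => [Ia|[b Ib Eab]].
  by exists a.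
rewrite -(subrK b a) memvD // (subvP sI12) // -lker_alg_pi memv_ker linearB /=.
by rewrite -/p1 Eab subrr.
Qed.

End QuotientMaps.

(** * The induced morphism on HH1 *)

Section InducedMap.
Variables (k : fieldType) (B C : falgType k) (f : 'AHom(B, C)) (m : nat).
Hypothesis f_onto : limg f = fullv.
Hypothesis kerf : lker f = (jacobson_rad B ^+ m.+1)%VS.

Lemma lker_sub_rad : (lker f <= jacobson_rad B)%VS.
Proof.
rewrite kerf; have /andP[_ Jf] := jacobson_rad_ideal B.
by rewrite expvSl (subv_trans _ Jf) // prodvSr ?subvf.
Qed.

(** The derivation of [C] induced by a derivation [d] of [B], that is
    [f \o d \o f^-1] with [f^-1] a linear section of [f].  The projection
    [vsproj] onto the derivations makes the definition total; it acts as the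
    identity here, because the composite is a derivation preserving the
    radical, as established within the proof of [Der_rad_pushE]. *)
Definition Der_rad_push (d : Der_rad B) : Der_rad C :=
  vsproj (Der_rad_vspace C) (f \o Der_rad_fun d \o f^-1)%VF.

Fact Der_rad_push_linear : linear Der_rad_push.
Proof.
move=> a d e; rewrite /Der_rad_push Der_rad_fun_linear.
by rewrite comp_lfunDr comp_lfunDl -comp_lfunZr -comp_lfunZl linearP.
Qed.
HB.instance Definition _ := GRing.isSemilinear.Build k (Der_rad B) (Der_rad C) _
  Der_rad_push (GRing.semilinear_linear Der_rad_push_linear).

(** The characteristic property of the induced derivation. *)
Lemma Der_rad_pushE d x : Der_rad_fun (Der_rad_push d) (f x) = f (Der_rad_fun d x).
Proof.
set g := (f \o Der_rad_fun d \o f^-1)%VF.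
have [dM dJ] := Der_radP d.
have gE y : g (f y) = f (Der_rad_fun d y).
  rewrite /g comp_lfunE (lfun_factor (g := (f \o Der_rad_fun d)%VF)) ?comp_lfunE //.
  apply/subvP => z; rewrite !memv_ker comp_lfunE -!memv_ker kerf.
  exact: (rad_derivation_radX (Der_radP d)).
suff Dg : g \in Der_rad_vspace C by rewrite /Der_rad_fun /Der_rad_push vsprojK ?gE.
apply/Der_rad_vspaceP; split=> [u v|u].
  have [a ->] := limg_fullP f_onto u; have [b ->] := limg_fullP f_onto v.
  by rewrite -rmorphM !gE dM rmorphD !rmorphM.
rewrite -(jacobson_rad_limg f_onto lker_sub_rad) => /memv_imgP[a Ja ->].
by rewrite gE memv_img ?dJ.
Qed.

Lemma Der_rad_push_lie d e : Der_rad_push (lie d e) = lie (Der_rad_push d) (Der_rad_push e).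
Proof.
apply: Der_rad_fun_inj; apply/lfunP => y; have [x ->] := limg_fullP f_onto y.
by rewrite Der_rad_pushE !Der_rad_lieE !Der_rad_pushE linearB.
Qed.

Lemma Der_rad_push_inner d : d \in (Inn B : {vspace _}) ->
  Der_rad_push d \in (Inn C : {vspace _}).
Proof.
move=> /InnP[b Eb]; apply/InnP; exists (f b) => y.
have [x ->] := limg_fullP f_onto y.
by rewrite Der_rad_pushE Eb linearB /= !rmorphM.
Qed.

Lemma limg_HH1_pi (D : falgType k) : limg (linfun (lie_pi (Inn D))) = fullv.
Proof.
apply/vspaceP => q; rewrite memvf; apply/memv_imgP; exists (vrepr q).
  exact: memvf.
by rewrite lfunE /= lie_reprK.
Qed.

(** The linear map sending the class of [d] to the class of [Der_rad_push d]. *)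
Definition HH1_rad_map : 'Hom(HH1_rad B, HH1_rad C) :=
  (linfun (lie_pi (Inn C)) \o linfun Der_rad_push \o (linfun (lie_pi (Inn B)))^-1)%VF.

Lemma HH1_rad_mapE d : HH1_rad_map (lie_pi (Inn B) d) = lie_pi (Inn C) (Der_rad_push d).
Proof.
have -> : lie_pi (Inn B) d = linfun (lie_pi (Inn B)) d by rewrite lfunE.
rewrite /HH1_rad_map comp_lfunE lfun_factor; first by rewrite comp_lfunE !lfunE.
apply/subvP => e; rewrite !memv_ker comp_lfunE !lfunE.
by rewrite !lie_pi_eq0; apply: Der_rad_push_inner.
Qed.

Lemma HH1_rad_map_lie : lie_morphism HH1_rad_map.
Proof.
move=> p q; rewrite -[p]lie_reprK -[q]lie_reprK.
rewrite [lie (lie_pi _ _) _]lie_pi_lie !HH1_rad_mapE Der_rad_push_lie.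
by rewrite [RHS]lie_pi_lie.
Qed.

Hypothesis m_gt0 : (0 < m)%N.
Hypothesis radX0 : (jacobson_rad B ^+ m.+2 = 0)%VS.

(** A class in the kernel is represented by a derivation with values in
    [lker f]. *)
Lemma HH1_rad_map_ker p : p \in lker HH1_rad_map ->
  exists2 d, p = lie_pi (Inn B) d & (limg (Der_rad_fun d) <= jacobson_rad B ^+ m.+1)%VS.
Proof.
rewrite memv_ker -[p]lie_reprK; set d := vrepr p.
rewrite HH1_rad_mapE lie_pi_eq0 => /InnP[c Ec].
have [b Eb] := limg_fullP f_onto c.
have Db : inner b \in Der_rad_vspace B.
  exact/Der_rad_vspaceP/inner_rad_derivation.
pose e : Der_rad B := Subvs Db.
have eE x : Der_rad_fun e x = b * x - x * b by exact: innerE.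
(* Subtracting [b, -] does not change the class of d. *)
exists (d - e).
  apply/eqP; rewrite -subr_eq0 -linearB /= opprB addrC subrK lie_pi_eq0.
  by apply/InnP; exists b.
apply/subvP => _ /memv_imgP[x _ ->]; rewrite -kerf memv_ker.
rewrite linearB /= add_lfunE opp_lfunE linearB /= eE.
by rewrite -Der_rad_pushE Ec Eb linearB /= !rmorphM subrr.
Qed.

Lemma HH1_rad_map_ker_abelian : abelian_subspace (lker HH1_rad_map).
Proof.
move=> _ _ /HH1_rad_map_ker[d -> dJ] /HH1_rad_map_ker[e -> eJ].
rewrite [LHS]lie_pi_lie; suff -> : lie d e = 0 by rewrite linear0.
have comp0 g h : (limg (Der_rad_fun g) <= jacobson_rad B ^+ m.+1)%VS ->
    (limg (Der_rad_fun h) <= jacobson_rad B ^+ m.+1)%VS ->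
    forall x, Der_rad_fun g (Der_rad_fun h x) = 0.
  move=> gJ /subvP hJ x; apply/eqP; rewrite -memv0 -radX0.
  apply: (rad_derivation_rad_sqr (Der_radP g) gJ).
  have := hJ _ (memv_img _ (memvf x)); apply/subvP.
  exact: jacobson_radX_sub.
apply: Der_rad_fun_inj; apply/lfunP => x.
by rewrite Der_rad_lieE !comp0 // subrr Der_rad_fun0.
Qed.

End InducedMap.

(** * Quotients by powers of the radical *)

Section RadicalQuotients.
Variables (k : fieldType) (A : falgType k).
Local Notation J := (jacobson_rad A).

Lemma jacobson_rad_rad_pow_quot n :
  jacobson_rad (alg_quot (rad_pow_ideal A n.+1)) =
    (alg_pi_ahom (rad_pow_ideal A n.+1) @: J)%VS.
Proof.
apply/esym/jacobson_rad_limg; first exact: limg_alg_pi.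
by rewrite lker_alg_pi -[J]expv1 jacobson_radX_sub.
Qed.

Lemma HH1_rad_quot_step n : exists f : 'Hom(HH1_rad (alg_quot (rad_pow_ideal A n.+3)),
                                           HH1_rad (alg_quot (rad_pow_ideal A n.+2))),
  lie_morphism f /\ abelian_subspace (lker f).
Proof.
have [|f f_onto kerf] := @alg_quot_ahom k A (rad_pow_ideal A n.+3) (rad_pow_ideal A n.+2).
  exact: jacobson_radX_sub.
rewrite /= aimgX -jacobson_rad_rad_pow_quot in kerf.
exists (HH1_rad_map f); split; first exact: HH1_rad_map_lie f_onto kerf.
apply: (HH1_rad_map_ker_abelian f_onto kerf) => //.
rewrite jacobson_rad_rad_pow_quot -aimgX; apply/eqP.
by rewrite -lkerE lker_alg_pi.
Qed.

Lemma solvable_HH1_rad_quot_step n :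
  solvable_lie (HH1_rad (alg_quot (rad_pow_ideal A n.+2))) ->
  solvable_lie (HH1_rad (alg_quot (rad_pow_ideal A n.+3))).
Proof.
by have [f [fL abK]] := HH1_rad_quot_step n; apply: solvable_lie_lift abK.
Qed.

Lemma solvable_HH1_rad_of_quot n : (J ^+ n.+2 = 0)%VS ->
  solvable_lie (HH1_rad (alg_quot (rad_pow_ideal A n.+2))) -> solvable_lie (HH1_rad A).
Proof.
move=> Jn0; set I := rad_pow_ideal A n.+2.
have onto := limg_alg_pi I; have ker := lker_alg_pi I.
have Jn0' : (J ^+ n.+3 = 0)%VS by rewrite expvSl Jn0 prodv0.
apply: (solvable_lie_lift (f := HH1_rad_map (alg_pi_ahom I))).
  exact: HH1_rad_map_lie onto ker.
exact: (HH1_rad_map_ker_abelian onto ker).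
Qed.

End RadicalQuotients.

Theorem corollary2p5 (k : fieldType) (A : falgType k)
    (sepA : separable_algebra (alg_quot (rad_ideal A)))
    (n : nat) (n_ge3 : (3 <= n)%N) :
  [/\ exists f : 'Hom(HH1_rad (alg_quot (rad_pow_ideal A n)),
                      HH1_rad (alg_quot (rad_pow_ideal A n.-1))),
        lie_morphism f /\ abelian_subspace (lker f),
      solvable_lie (HH1_rad (alg_quot (rad_pow_ideal A n.-1))) ->
        solvable_lie (HH1_rad (alg_quot (rad_pow_ideal A n)))
    & solvable_lie (HH1_rad (alg_quot (rad_pow_ideal A 2))) ->
        solvable_lie (HH1_rad A)].
Proof.
case: n n_ge3 => [|[|[|n]]] // _.
split; [exact: HH1_rad_quot_step | exact: solvable_HH1_rad_quot_step | move=> sol2].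
have [N JN0] := jacobson_rad_nilpotent A.
apply: (@solvable_HH1_rad_of_quot k A N); first by rewrite expvSl JN0 prodv0.
by elim: N {JN0} => [|N IHN] //; apply: solvable_HH1_rad_quot_step.
Qed.
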